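(* Let $d\geq 1$ and $L\geq 2$ be integers and let $\mathcal{L}:\mathbb{R}^d\to\mathbb{R}$ be differentiable with $\arg\min_{\theta\in\mathbb{R}^d}\mathcal{L}(\theta)\neq\emptyset$, and let $\mathcal{L}^*=\min_{\theta\in\mathbb{R}^d}\mathcal{L}(\theta)$. Let $u^1,\dots,u^L:[0,+\infty)\to\mathbb{R}^d$ be a solution of the gradient flow system $$\forall j\in[L],\ \forall t\geq 0,\qquad \frac{du^j(t)}{dt}+\Big(\bigodot_{k\neq j}u^k(t)\Big)\odot\nabla\mathcal{L}(\theta(t))=0,\qquad \theta(t)=\bigodot_{j=1}^L u^j(t).$$ Assume that for every $i\in[d]$ the set $\arg\min_{k\in[L]}|u^k_i(0)|$ has exactly one element, denoted $k_i$. Assume that $\mathcal{L}$ satisfies the Polyak-Łojasiewicz property with parameter $\mu>0$. Then for all $t\geq 0$, $$\mathcal{L}(\theta(t))-\mathcal{L}^*\leq e^{-2\sigma\mu t}\big(\mathcal{L}(\theta(0))-\mathcal{L}^*\big),\qquad\text{where}\quad \sigma=\min_{i\in[d]}\prod_{k\in[L],\,k\neq k_i}\big(u^k_i(0)^2-u^{k_i}_i(0)^2\big).$$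
   Context: Notation: $[L]=\{1,\dots,L\}$; $u^j_i$ is the $i$-th component of $u^j$; $\odot$ is the Hadamard (componentwise) product on $\mathbb{R}^d$, and $\bigodot_{j}u^j$ is the vector with $i$-th component $\prod_j u^j_i$. The index $L$ (number of layers) is distinct from the loss function $\mathcal{L}$. The function $\mathcal{L}$ satisfies the Polyak-Łojasiewicz property with parameter $\mu>0$ if $2\mu(\mathcal{L}(\theta)-\mathcal{L}^* )\leq\|\nabla\mathcal{L}(\theta)\|^2$ for all $\theta\in\mathbb{R}^d$, where $\|\cdot\|$ is the Euclidean norm. *)

(* Defs.v *)
From mathcomp Require Import all_boot all_order all_algebra.
From mathcomp Require Import all_classical all_reals all_analysis.

Set Implicit Arguments.
Unset Strict Implicit.
Unset Printing Implicit Defensive.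

Import Order.TTheory GRing.Theory Num.Theory.
Import numFieldNormedType.Exports.

Local Open Scope classical_set_scope.
Local Open Scope ring_scope.

Definition argmin_set (R : realType) (T : Type) (f : T -> R) : set T :=
  [set x | forall y, f x <= f y].

Definition is_min (R : realType) (A : set R) (m : R) : Prop :=
  A m /\ lbound A m.

(* The library norm on 'rV[R]_d is the sup norm; differentiability does not
   depend on the choice, but the Polyak-Lojasiewicz inequality does. *)
Definition euclidean_norm (R : realType) (d : nat) (v : 'rV[R]_d) : R :=
  Num.sqrt (\sum_(i < d) v 0 i ^+ 2).

Definition gradient (R : realType) (d : nat) (f : 'rV[R]_d -> R)
    (x : 'rV[R]_d) : 'rV[R]_d :=
  \row_(i < d) 'D_(delta_mx 0 i) f x.

Definition polyak_lojasiewicz (R : realType) (d : nat) (loss : 'rV[R]_d -> R)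
    (lstar mu : R) : Prop :=
  forall x : 'rV[R]_d,
    2 * mu * (loss x - lstar) <= euclidean_norm (gradient loss x) ^+ 2.

Definition hadamard (R : realType) (d : nat) (v w : 'rV[R]_d) : 'rV[R]_d :=
  map2_mx *%R v w.

Definition hadamard_prod (R : realType) (d L : nat) (P : pred 'I_L)
    (v : 'I_L -> 'rV[R]_d) : 'rV[R]_d :=
  \row_(i < d) \prod_(j < L | P j) v j 0 i.

(* Derivative relative to A: on `[0, +oo[ it is the two-sided derivative at
   t > 0 and the right derivative at t = 0. *)
Definition is_derivative_in (R : realType) (d : nat) (A : set R)
    (f : R -> 'rV[R]_d) (t : R) (v : 'rV[R]_d) : Prop :=
  (s - t)^-1 *: (f s - f t) @[s --> within A t^'] --> v.

Definition theta (R : realType) (d L : nat) (u : 'I_L -> R -> 'rV[R]_d)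
    (t : R) : 'rV[R]_d :=
  hadamard_prod predT (fun j => u j t).

(* The trajectories are total functions on R, but only their values on
   [0, +oo) are constrained. *)
Definition gradient_flow (R : realType) (d L : nat) (loss : 'rV[R]_d -> R)
    (u : 'I_L -> R -> 'rV[R]_d) : Prop :=
  forall (j : 'I_L) (t : R), 0 <= t ->
    exists2 du : 'rV[R]_d,
      is_derivative_in `[0, +oo[ (u j) t du &
      du + hadamard (hadamard_prod (predC1 j) (fun k => u k t))
                    (gradient loss (theta u t)) = 0.

(* Main.v *)
Require Import Defs.
From mathcomp Require Import all_boot all_order all_algebra.
From mathcomp Require Import all_classical all_reals all_analysis.
Import Order.TTheory GRing.Theory Num.Theory.
Import numFieldNormedType.Exports.
Local Open Scope classical_set_scope.
Local Open Scope ring_scope.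

(** Along the flow, d(u^j_i)^2/dt = -2 theta_i (grad L)_i does not depend on j,
    so u^j_i ^ 2 - u^k_i ^ 2 is conserved.  Taking k = k_i,
      prod_{j <> k_i} u^j_i(t)^2 >= prod_{j <> k_i} (u^j_i(0)^2 - u^{k_i}_i(0)^2)
                                 >= sigma >= 0.
    As theta_i' = - sum_j (prod_{k <> j} u^k_i)^2 (grad L)_i, keeping only j = k_i
    gives dL(theta)/dt <= - sigma |grad L|^2 <= - 2 sigma mu (L(theta) - min L),
    and e^(2 sigma mu t) (L(theta) - min L) is nonincreasing. *)

(** * Derivatives relative to the half-line *)

Lemma is_derive_coord (R : realType) (d : nat) (f : R -> 'rV[R]_d) (t : R)
    (v : 'rV[R]_d) (i : 'I_d) :
  0 < t -> is_derivative_in `[0, +oo[ f t v ->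
  is_derive t 1 (fun s => f s 0 i) (v 0 i).
Proof.
move=> t0 fv.
(* As [t > 0], a whole neighbourhood of [t] lies in the half-line, so the relative limit is
   two-sided; [s = h + t] turns its quotient into the one in [derive]. *)
have shiftP : (h + t) @[h --> 0^'] --> within `[0, +oo[ t^'.
  move=> P tP.
  have ct : (h + t) @[h --> (0 : R)] --> t.
    by rewrite -[X in _ --> X]add0r; apply: cvgD; [exact: cvg_id|exact: cvg_cst].
  have tN : \forall s \near t, s != t -> P s.
    have {}tP : \forall s \near t, s != t -> `[0, +oo[%classic s -> P s := tP.
    have : \forall s \near t, 0 < s by exact: lt_nbhsr.
    apply: filterS2 tP => s sP s0 st.
    by apply: sP => //; rewrite /= in_itv/= ltW.
  have : \forall h \near 0, h + t != t -> P (h + t) := ct _ tN.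
  apply: filterS => h hP h0.
  by apply: hP; rewrite -subr_eq0 addrK.
have qv : (h^-1 *: (f (h + t) 0 i - f t 0 i)) @[h --> 0^'] --> v 0 i.
  have := cvg_comp _ _ (cvg_comp _ _ shiftP fv) (@coord_continuous _ _ _ 0 i v).
  by apply: cvg_trans; apply: near_eq_cvg; near=> h; rewrite /= addrK !mxE.
have E : (fun h : R => h^-1 *: (((fun s => f s 0 i) \o shift t) (h *: 1) - f t 0 i)) =
  (fun h => h^-1 *: (f (h + t) 0 i - f t 0 i)).
  by apply/funext => h /=; rewrite [h *: 1]mulr1.
split; first by apply/cvg_ex; exists (v 0 i); rewrite E.
by rewrite /derive E; exact: cvg_lim qv.
Unshelve. all: by end_near. Qed.

(** The increment is [s] times a convergent difference quotient. Right continuity is all that is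
    kept of the flow equation at time 0. *)
Lemma cvg_right_coord (R : realType) (d : nat) (f : R -> 'rV[R]_d)
    (v : 'rV[R]_d) (i : 'I_d) :
  is_derivative_in `[0, +oo[ f 0 v ->
  f s 0 i @[s --> 0^'+] --> f 0 0 i.
Proof.
move=> fv.
have fv' : s^-1 *: (f s 0 i - f 0 0 i) @[s --> 0^'+] --> v 0 i.
  have sub : 0^'+ `=>` within `[0, +oo[ (0 : R)^'.
    move=> P P0.
    have : \forall s \near (0 : R), s != 0 -> `[0, +oo[%classic s -> P s := P0.
    apply: filterS => s sP s0.
    by apply: sP; [rewrite gt_eqF|rewrite /= in_itv/= ltW].
  have := cvg_comp _ _ (cvg_trans (cvg_fmap2 sub) fv) (@coord_continuous _ _ _ 0 i v).
  by apply: cvg_trans; apply: near_eq_cvg; near=> h; rewrite /= subr0 !mxE.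
have id0 : s @[s --> (0 : R)^'+] --> (0 : R) by exact: cvg_within.
have : s * (s^-1 *: (f s 0 i - f 0 0 i)) + f 0 0 i @[s --> 0^'+] --> f 0 0 i.
  rewrite -[X in _ --> X]add0r -[X in _ --> X + _](mul0r (v 0 i)).
  by apply: cvgD; [exact: cvgM|exact: cvg_cst].
apply: cvg_trans; apply: near_eq_cvg; near=> s.
have s0 : 0 < s by near: s; exact: nbhs_right_gt.
by rewrite [_ *: _]/(_ * _) mulrA mulfV ?gt_eqF// mul1r subrK.
Unshelve. all: by end_near. Qed.

(** Continuity up to the endpoint lets the sign of the derivative on the open half-line decide, so
    nothing has to be differentiated at 0. *)
Lemma nonincreasing_le0 (R : realType) (f f' : R -> R) :
  f s @[s --> 0^'+] --> f 0 ->
  (forall s : R, 0 < s -> is_derive s 1 f (f' s)) ->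
  (forall s : R, 0 < s -> f' s <= 0) ->
  forall t : R, 0 <= t -> f t <= f 0.
Proof.
move=> f0 fd f'0 t t0.
apply: (@ler0_derive1_nincry _ f 0) => //.
- by move=> x; rewrite in_itv/= andbT => /fd[].
- move=> x; rewrite in_itv/= andbT => x0.
  by rewrite derive1E (@derive_val _ _ _ _ _ _ _ (fd _ x0)) f'0.
- apply/continuous_within_itvcyP; split => // x; rewrite in_itv/= andbT.
  move=> /fd[/derivable1_diffP + _].
  exact: differentiable_continuous.
Qed.

(** * Leibniz and chain rules *)

Lemma is_derive_prod_seq (R : realType) (I : eqType) (r : seq I) (f : I -> R -> R)
    (df : I -> R) (t : R) : uniq r ->
  (forall j, is_derive t 1 (f j) (df j)) ->
  is_derive t 1 (fun s => \prod_(j <- r) f j s)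
    (\sum_(j <- r) (\prod_(k <- r | k != j) f k t) * df j).
Proof.
move=> + fd; elim: r => [_|a r IH /= /andP[ar ur]].
  rewrite big_nil; under eq_fun do rewrite big_nil; exact: is_derive_cst.
under eq_fun do rewrite big_cons.
(* Since [a] is not in [r], the filter [k != j] keeps the factor [f a] for every [j] in [r], and for
   [j = a] it leaves the full product over [r]. *)
have -> : \sum_(j <- a :: r) (\prod_(k <- (a :: r) | k != j) f k t) * df j =
    f a t *: (\sum_(j <- r) (\prod_(k <- r | k != j) f k t) * df j) +
    (\prod_(j <- r) f j t) *: df a.
  rewrite big_cons big_cons eqxx /= addrC; congr (_ + _).
    rewrite [_ *: _]mulr_sumr big_seq [RHS]big_seq; apply: eq_bigr => j jr.
    rewrite big_cons; case: eqVneq => [aj|_]; first by rewrite aj jr in ar.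
    by rewrite mulrA.
  congr (_ * _); rewrite big_seq_cond [RHS]big_seq; apply: eq_bigl => j.
  by case: eqVneq => [->|]; rewrite ?andbT// (negbTE ar).
by apply: is_deriveM; exact: IH.
Qed.

Lemma is_derive_gradient (R : realType) (d : nat) (f : 'rV[R]_d -> R)
    (x : R -> 'rV[R]_d) (dx : 'I_d -> R) (t : R) :
  differentiable f (x t) ->
  (forall i, is_derive t 1 (fun s => x s 0 i) (dx i)) ->
  is_derive t 1 (f \o x) (\sum_(i < d) dx i * gradient f (x t) 0 i).
Proof.
move=> fx xd.
have xt : derivable x t 1.
  by apply/derivable_mxP => i j; rewrite ord1; have [] := xd j.
have dxt : differentiable x t by exact/derivable1_diffP.
have dxE : 'd x t 1 = \row_i dx i.
  rewrite -deriveE// derive_mx//; apply/rowP => i.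
  by rewrite !mxE (@derive_val _ _ _ _ _ _ _ (xd i)).
split; first exact/derivable1_diffP/differentiable_comp.
rewrite deriveE; last exact: differentiable_comp.
(* Expanding the velocity in the canonical basis, linearity of the differential leaves the partial
   derivatives that form [gradient]. *)
rewrite diff_comp//= dxE [X in 'd _ _ X]row_sum_delta linear_sum.
by apply: eq_bigr => i _; rewrite linearZ /= !mxE -deriveE.
Qed.

Lemma cvg_right_comp_coord (R : realType) (d : nat) (f : 'rV[R]_d -> R)
    (x : R -> 'rV[R]_d) :
  differentiable f (x 0) ->
  (forall i, x s 0 i @[s --> 0^'+] --> x 0 0 i) ->
  f (x s) @[s --> 0^'+] --> f (x 0).
Proof.
move=> /differentiable_continuous fc xc.
suff x0 : x s @[s --> 0^'+] --> x 0 by exact: (cvg_comp x f x0 fc).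
(* Written in the canonical basis, the row is a finite sum of coordinates times fixed vectors, so
   coordinatewise limits suffice. *)
rewrite [x 0]row_sum_delta; under eq_cvg do rewrite [x _]row_sum_delta.
by apply: cvg_big => [|i _]; [exact: add_continuous|exact: cvgZr_tmp].
Qed.

(** * Coordinates of the flow and their conserved quantities *)

Section GradientFlow.
Context (R : realType) (d L : nat) (loss : 'rV[R]_d -> R)
  (u : 'I_L -> R -> 'rV[R]_d) (u_flow : gradient_flow loss u).

Let g (t : R) (i : 'I_d) : R := gradient loss (theta u t) 0 i.

Lemma is_derive_flow (j : 'I_L) (i : 'I_d) (t : R) : 0 < t ->
  is_derive t 1 (fun s => u j s 0 i)
    (- (\prod_(k < L | k != j) u k t 0 i * g t i)).
Proof.
move=> t0; have [v uv /eqP] := u_flow j t (ltW t0).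
rewrite addr_eq0 => /eqP vE.
have := is_derive_coord _ _ _ _ _ i t0 uv.
by rewrite vE /g !mxE.
Qed.

Lemma cvg_right_flow (j : 'I_L) (i : 'I_d) :
  u j s 0 i @[s --> 0^'+] --> u j 0 0 i.
Proof. by have [v uv _] := u_flow j 0 (lexx 0); exact: cvg_right_coord uv. Qed.

Lemma flow_conserved (j k : 'I_L) (i : 'I_d) (t : R) : 0 <= t ->
  u j t 0 i ^+ 2 - u k t 0 i ^+ 2 = u j 0 0 i ^+ 2 - u k 0 0 i ^+ 2.
Proof.
(* One inequality for all pairs is enough: exchanging [p] and [q] reverses it. *)
move=> t0; suff le p q : u p t 0 i ^+ 2 - u q t 0 i ^+ 2 <=
    u p 0 0 i ^+ 2 - u q 0 0 i ^+ 2.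
  by apply/le_anti; rewrite le/= -lerN2 !opprB le.
apply: (@nonincreasing_le0 _ (fun s => u p s 0 i ^+ 2 - u q s 0 i ^+ 2)
  (fun=> 0)) t0 => [|s s0|//].
  by apply: cvgB; apply: cvgM; exact: cvg_right_flow.
(* The factor [u r] completes the product over [k != r] into the full one, which no longer depends
   on [r]. *)
have sqd r : is_derive s 1 (fun s => u r s 0 i ^+ 2)
    (- (\prod_(k < L) u k s 0 i * g s i) *+ 2).
  rewrite mulr2n [\prod_(k < L) _](bigD1 r)//= -mulrA -mulrN.
  by have ur := is_derive_flow r i s s0; exact: is_deriveM.
rewrite -(subrr (- (\prod_(k < L) u k s 0 i * g s i) *+ 2)).
exact: is_deriveB.
Qed.

(** In the Leibniz sum the cofactor of the derivative of [u j] is the very product that this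
    derivative contains, whence the squares. *)
Lemma is_derive_theta (i : 'I_d) (t : R) : 0 < t ->
  is_derive t 1 (fun s => theta u s 0 i)
    (- ((\sum_(j < L) (\prod_(k < L | k != j) u k t 0 i) ^+ 2) * g t i)).
Proof.
move=> t0.
have -> : (fun s => theta u s 0 i) = (fun s => \prod_(j < L) u j s 0 i).
  by apply/funext => s; rewrite mxE.
have := @is_derive_prod_seq _ _ _ (fun j s => u j s 0 i) _ t
  (index_enum_uniq 'I_L) (fun j => is_derive_flow j i t t0).
congr is_derive; rewrite mulr_suml -sumrN; apply: eq_bigr => j _.
by rewrite mulrN mulrA expr2.
Qed.

Lemma cvg_right_theta (i : 'I_d) :
  theta u s 0 i @[s --> 0^'+] --> theta u 0 0 i.
Proof.
rewrite mxE; under eq_cvg do rewrite mxE.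
by apply: cvg_big => [|j _]; [exact: mul_continuous|exact: cvg_right_flow].
Qed.

End GradientFlow.

(** * Lower bound by [sigma] and exponential decay *)

Lemma le_normr_sqr (R : realDomainType) (x y : R) :
  `|x| <= `|y| -> x ^+ 2 <= y ^+ 2.
Proof.
move=> xy; rewrite -[leLHS]real_normK ?num_real//.
by rewrite -[leRHS]real_normK ?num_real// lerXn2r ?nnegrE.
Qed.

(** Conservation bounds each factor separately; minimality of [m] at time 0 makes the lower bounds
    nonnegative, so that they may be multiplied. *)
Lemma prod_sqr_flow_ge (R : realType) (d L : nat) (loss : 'rV[R]_d -> R)
    (u : 'I_L -> R -> 'rV[R]_d) (i : 'I_d) (m : 'I_L) (t : R) :
  gradient_flow loss u ->
  (forall j, `|u m 0 0 i| <= `|u j 0 0 i|) -> 0 <= t ->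
  \prod_(j < L | j != m) (u j 0 0 i ^+ 2 - u m 0 0 i ^+ 2) <=
    (\prod_(j < L | j != m) u j t 0 i) ^+ 2.
Proof.
move=> u_flow mmin t0; rewrite -prodrXl; apply: ler_prod => j _.
rewrite subr_ge0 le_normr_sqr//= -(flow_conserved _ _ _ _ _ u_flow _ _ _ _ t0).
by rewrite gerBl sqr_ge0.
Qed.

Theorem theorem2 (R : realType) (d L : nat) (d_ge1 : (1 <= d)%N)
    (L_ge2 : (2 <= L)%N)
    (loss : 'rV[R]_d -> R)
    (loss_diff : forall x : 'rV[R]_d, differentiable loss x)
    (loss_argmin : argmin_set loss !=set0)
    (lstar : R) (lstar_min : is_min (range loss) lstar)
    (u : 'I_L -> R -> 'rV[R]_d) (u_flow : gradient_flow loss u)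
    (k : 'I_d -> 'I_L)
    (k_argmin : forall i : 'I_d,
        argmin_set (fun j : 'I_L => `|u j 0 0 i|) = [set k i])
    (mu : R) (mu_gt0 : 0 < mu)
    (loss_PL : polyak_lojasiewicz loss lstar mu)
    (sigma : R)
    (sigma_min : is_min
        (range (fun i : 'I_d =>
          \prod_(j < L | j != k i) (u j 0 0 i ^+ 2 - u (k i) 0 0 i ^+ 2)))
        sigma) :
  forall t : R, 0 <= t ->
    loss (theta u t) - lstar <=
      expR (- 2 * sigma * mu * t) * (loss (theta u 0) - lstar).
Proof.
have k_min (i : 'I_d) : argmin_set (fun j => `|u j 0 0 i|) (k i).
  by rewrite k_argmin.
pose w := 2 * sigma * mu.
have sig_le (i : 'I_d) (t : R) : 0 <= t ->
    sigma <= (\prod_(j < L | j != k i) u j t 0 i) ^+ 2.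
  move=> t0; have /le_trans : sigma <=
    \prod_(j < L | j != k i) (u j 0 0 i ^+ 2 - u (k i) 0 0 i ^+ 2).
    by apply: sigma_min.2; exists i.
  apply; apply: prod_sqr_flow_ge t0; first exact: u_flow.
  exact: k_min.
have sig_ge0 : 0 <= sigma.
  (* A minimum is attained, so [sigma] is itself one of these products of nonnegative factors. *)
  have [[i _ <-] _] := sigma_min; apply: prodr_ge0 => j _.
  by rewrite subr_ge0 le_normr_sqr// k_min.
pose g (t : R) (i : 'I_d) := gradient loss (theta u t) 0 i.
pose G (t : R) := \sum_(i < d) g t i ^+ 2.
(* [dl] is the derivative of the loss along [theta], as the chain rule produces it. *)
pose dl (t : R) := \sum_(i < d)
  - ((\sum_(j < L) (\prod_(k < L | k != j) u k t 0 i) ^+ 2) * g t i) * g t i.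
have PL (t : R) : 2 * mu * (loss (theta u t) - lstar) <= G t.
  apply: le_trans (loss_PL _) _; rewrite sqr_sqrtr// sumr_ge0// => i _.
  exact: sqr_ge0.
have dl_le (t : R) : 0 < t -> dl t <= - sigma * G t.
  move=> t0; rewrite mulr_sumr; apply: ler_sum => i _.
  rewrite !mulNr lerN2 -mulrA -expr2 ler_wpM2r ?sqr_ge0//.
  apply: le_trans (sig_le i t (ltW t0)) _.
  by rewrite [leRHS](bigD1 (k i))//= lerDl sumr_ge0// => j _; exact: sqr_ge0.
pose h (s : R) := expR (w * s) * (loss (theta u s) - lstar).
pose dh (s : R) := expR (w * s) * dl s +
  (loss (theta u s) - lstar) * (w * expR (w * s)).
have h0 : h s @[s --> 0^'+] --> h 0.
  apply: cvgM.
    apply: cvg_at_right_filter; apply: continuous_comp; last exact: continuous_expR.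
    exact: mulrl_continuous.
  apply: cvgB; last exact: cvg_cst.
  by apply: cvg_right_comp_coord => // i; exact: cvg_right_theta u_flow i.
have hd (s : R) : 0 < s -> is_derive s 1 h (dh s).
  move=> s0.
  have dls : is_derive s 1 (fun r => loss (theta u r) - lstar) (dl s).
    rewrite -[dl s]subr0; apply: is_deriveB.
    apply: is_derive_gradient => // i; exact: is_derive_theta u_flow i s s0.
  have dexp : is_derive s 1 (fun r : R => expR (w * r)) (w * expR (w * s)).
    rewrite -[X in X * expR _]mulr1 mulrC.
    have wd : is_derive s 1 (fun r : R => w * r) (w * 1) by exact: is_deriveZ.
    exact: (is_derive1_comp (is_derive_expR (w * s)) wd).
  exact: is_deriveM.
have dh_le0 (s : R) : 0 < s -> dh s <= 0.
  move=> s0.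
  have -> : dh s = expR (w * s) * (dl s + w * (loss (theta u s) - lstar)).
    rewrite mulrDr [X in _ = _ + X]mulrCA [X in _ = _ + _ * X]mulrC.
    by rewrite [X in _ = _ + X]mulrCA.
  rewrite pmulr_rle0 ?expR_gt0//.
  have -> : w * (loss (theta u s) - lstar) =
      sigma * (2 * mu * (loss (theta u s) - lstar)).
    by rewrite /w [2 * sigma]mulrC !mulrA.
  (* The descent bound [- sigma * G s] cancels against the Polyak-Łojasiewicz inequality multiplied
     by [sigma >= 0]. *)
  rewrite (le_trans (lerD (dl_le s s0) (ler_wpM2l sig_ge0 (PL s))))//.
  by rewrite mulNr addNr.
move=> t t0; have := nonincreasing_le0 _ h dh h0 hd dh_le0 t t0.
rewrite /h mulr0 expR0 mul1r -ler_pdivlMl ?expR_gt0// -expRN.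
by congr (_ <= expR _ * _); rewrite /w !mulNr.
Qed.
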